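(* Let $X$ be a finite set and let $\mathcal{D}\subseteq\mathcal{R}(X)$ be a maximal Condorcet domain. If the associated graph $\Gamma_{\mathcal{D}}$ is a tree, then it is a chain (path graph).
   Context: $\mathcal{R}(X)$ is the set of strict linear orders on $X$. A profile over $\mathcal{D}$ is $(R_1,\dots,R_n)\in\mathcal{D}^n$; its majority relation ranks $x$ above $y$ iff more than half of the voters do. $\mathcal{D}$ is a Condorcet domain if the majority relation of every profile over $\mathcal{D}$ is acyclic; it is maximal if no Condorcet domain on $X$ properly contains it. For $R,R'\in\mathcal{R}(X)$ let $[R,R']=\{Q\in\mathcal{R}(X): Q\supseteq R\cap R'\}$; $\Gamma_{\mathcal{D}}$ is the graph on $\mathcal{D}$ with distinct $R,R'$ adjacent iff $[R,R']\cap\mathcal{D}=\{R,R'\}$. *)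

(* Defs.v *)
From mathcomp Require Import all_boot.

Set Implicit Arguments.
Unset Strict Implicit.
Unset Printing Implicit Defensive.

Section CondorcetDomains.

Variable X : finType.

(* A binary relation on X is its set of pairs; (x, y) \in R means that
   R ranks x above y. *)
Definition linear_orders : {set {set X * X}} :=
  [set R : {set X * X} |
    [&& [forall x, (x, x) \notin R],
        [forall x, forall y, forall z,
          ((x, y) \in R) ==> ((y, z) \in R) ==> ((x, z) \in R)]
      & [forall x, forall y, (x != y) ==> ((x, y) \in R) || ((y, x) \in R)]]].

Definition majority (n : nat) (P : 'I_n -> {set X * X}) : rel X :=
  fun x y => n < 2 * #|[set i : 'I_n | (x, y) \in P i]|.

(* [cycle r s] holds trivially for the empty sequence. *)
Definition acyclic (r : rel X) : Prop :=
  forall s : seq X, cycle r s -> s = [::].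

Definition condorcet_domain (D : {set {set X * X}}) : Prop :=
  D \subset linear_orders /\
  forall (n : nat) (P : 'I_n -> {set X * X}),
    (forall i, P i \in D) -> acyclic (majority P).

Definition maximal_condorcet_domain (D : {set {set X * X}}) : Prop :=
  condorcet_domain D /\
  forall D' : {set {set X * X}}, condorcet_domain D' -> ~~ (D \proper D').

Definition order_interval (R R' : {set X * X}) : {set {set X * X}} :=
  [set Q in linear_orders | R :&: R' \subset Q].

Definition associated_graph (D : {set {set X * X}}) :
    rel {R : {set X * X} | R \in D} :=
  fun R R' => (R != R') &&
    (order_interval (val R) (val R') :&: D == [set val R; val R']).

Lemma associated_graph_sym D : symmetric (@associated_graph D).
Proof.
move=> R R'; rewrite /associated_graph /order_interval eq_sym.
by rewrite [val R :&: _]setIC [[set val R; _]]setUC.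
Qed.

Lemma associated_graph_irr D : irreflexive (@associated_graph D).
Proof. by move=> R; rewrite /associated_graph eqxx. Qed.

End CondorcetDomains.

Section Graphs.

(* Finite simple graphs, given by a symmetric irreflexive adjacency
   relation on the type of vertices. *)
Variables (T : finType) (e : rel T).

Definition is_tree : Prop :=
  [/\ 0 < #|T|,
      forall x y : T, connect e x y
    & forall s : seq T, 2 < size s -> ~ ucycle e s].

Definition is_path_graph : Prop :=
  exists n : nat, exists2 f : T -> 'I_n, bijective f &
    forall x y : T,
      e x y = ((f x).+1 == f y :> nat) || ((f y).+1 == f x :> nat).

End Graphs.

(* Main.v *)
(** Let [R -- R'] be an edge of the tree and swap in [R] a consecutive pair
    on which [R'] disagrees.  Members of [D] sharing a pair are joined by a walk
    through members sharing it; hence a cyclic triple created by adding the swapped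
    order to [D] would give a walk from [R] to [R'] avoiding the edge.  By maximality
    the swapped order is in [D], so it is [R']: every edge is a swap of a consecutive pair.
    If [R] had three neighbours, two of the swapped pairs would be disjoint.
    Performing both swaps gives an order whose restriction to any three
    alternatives already occurs in [D], so it lies in [D] and closes a 4-cycle.
    Thus the tree has maximal degree two. *)

Require Import Defs.
From mathcomp Require Import all_boot.
From mathcomp Require Import zify.

Set Implicit Arguments.
Unset Strict Implicit.
Unset Printing Implicit Defensive.

(** * Acyclic connected graphs of maximal degree two are paths *)

Section TreesOfDegreeTwo.

Variables (T : finType) (e : rel T).
Hypotheses (esym : symmetric e) (eirr : irreflexive e).

Definition delete_edge (x y : T) : rel T :=
  fun u v => e u v && ([set u; v] != [set x; y]).

Hypothesis acyc : forall s : seq T, 2 < size s -> ~ ucycle e s.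

(** A detour from [x] to [y], shortened to repeat no vertex, would close up with the edge to a
    cycle. It has at least three vertices, since a one-step detour is the deleted edge itself. *)
Lemma tree_edge_is_bridge x y : e x y -> ~~ connect (delete_edge x y) x y.
Proof.
move=> exy; apply/negP => /connectP[p /shortenP[q qpath quniq _] lq].
have sub : subrel (delete_edge x y) e by move=> u v /andP[].
apply: (acyc (s := x :: q)); last first.
  by apply/andP; split=> //=; rewrite rcons_path (sub_path sub qpath) -lq esym.
case: q qpath quniq lq => [|z [|w q]] //= qpath _ lq.
  by rewrite lq eirr in exy.
by move: qpath; rewrite -lq /delete_edge eqxx andbF.
Qed.

Hypothesis conn : forall x y : T, connect e x y.
Hypothesis deg2 : forall x y1 y2 y3 : T,
  uniq [:: y1; y2; y3] -> e x y1 -> e x y2 -> e x y3 -> False.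

(** A longest simple path is closed under adjacency: a neighbour off the path would extend it at an
    end, or be a third neighbour of an interior vertex. Connectedness then makes the path exhaust
    [T]. *)
Lemma hamiltonian_path : exists s : seq T, [/\ uniq s, sorted e s & s =i predT].
Proof.
pose P k := [exists t : k.-tuple T, uniq t && sorted e t].
have P0 : exists k, P k by exists 0; apply/existsP; exists [tuple].
have Pbd k : P k -> k <= #|T|.
  case/existsP=> t /andP[ut _]; rewrite -{1}(size_tuple t).
  by rewrite -(card_uniqP ut) max_card.
case: (ex_maxnP P0 Pbd) => k /existsP[t /andP[ut st]] kmax.
have tmax s : uniq s -> sorted e s -> size s <= size t.
  move=> us ss; rewrite size_tuple; apply: kmax.
  by apply/existsP; exists (in_tuple s); rewrite us ss.
move: (tval t) ut st tmax => s us ss smax {t k kmax P P0 Pbd}.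
exists s; split=> // v; rewrite inE.
case: s us ss smax => [|x p] us ss smax; first by have := smax [:: v] isT isT.
have closed_s u w : u \in x :: p -> e u w -> w \in x :: p.
  move=> us' euw; apply/negPn/negP => wNs.
  case/splitPr: us' us ss smax wNs => p1 p2 us ss smax wNs.
  case: (lastP p1) us ss smax wNs => [|p1' a] us ss smax wNs.
    have := smax [:: w, u & p2]; rewrite /= ltnn => H; apply/notF/H.
      by rewrite wNs.
    by rewrite esym euw.
  case: p2 us ss smax wNs => [|b p2] us ss smax wNs.
    have := smax (rcons (rcons p1' a ++ [:: u]) w).
    rewrite size_rcons ltnn => H; apply/notF/H; first by rewrite rcons_uniq wNs.
    by rewrite rcons_cat sorted_cat_cons -cats1 ss /= euw.
  (* Here [u] is interior, so [a], [b] and [w] are three distinct neighbours of it. *)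
  move: ss; rewrite -cats1 -catA /= => ss.
  have /and3P[_ eau /andP[eub _]] :
      [&& sorted e (rcons p1' a), e a u & path e u (b :: p2)].
    by rewrite -[e a u && _]/(path e a [:: u, b & p2]) -sorted_cat_cons.
  apply: (@deg2 u a b w) => //; last by rewrite esym.
  move: us wNs; rewrite -cats1 -catA /= cat_uniq => /and3P[_ _ /= /andP[aN _]].
  rewrite mem_cat !inE !negb_or => /and5P[_ wa _ wb _].
  move: aN; rewrite !inE !negb_or => /and3P[_ ab _].
  by rewrite ab eq_sym wa eq_sym wb.
have conn_sym : connect_sym e by exact: sym_connect_sym.
rewrite -(closed_connect (intro_closed conn_sym _) (conn x v)) ?mem_head //.
by move=> u w euw us'; apply: closed_s euw.
Qed.

Lemma sorted_adjacent_index s x y : uniq s -> sorted e s -> y \in s ->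
  e x y -> index x s < index y s -> (index x s).+1 = index y s.
Proof.
move=> us ss ys exy ixy.
have xs : x \in s by rewrite -index_mem (ltn_trans ixy) // index_mem.
case/splitPr: xs us ss ys ixy => p1 p2; rewrite sorted_cat_cons cat_uniq.
case/and3P=> _ /hasPn p1N /= /andP[xp2 up2] /andP[_ pxp2].
have xp1 : x \notin p1 by apply: p1N; rewrite mem_head.
rewrite mem_cat inE !index_cat (negPf xp1) /= eqxx addn0.
case: (boolP (y \in p1)) => /= yp1.
  by rewrite ltnNge index_size.
case/orP=> [/eqP yx|yp2]; first by rewrite -yx eirr in exy.
rewrite eq_sym (negPf (memPn xp2 _ yp2)) => _; rewrite addnS; congr _.+1.
case/splitPr: yp2 xp2 up2 pxp2 {yp1 p1N} => p3 p4 xp2 up2 pxp2.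
(* [p3] is the stretch of the path strictly between [x] and [y]. If it is not empty, the edge from
   [y] back to [x] closes a cycle. *)
case: p3 xp2 up2 pxp2 => [|z p3] xp2 up2 pxp2; first by rewrite /= eqxx addn0.
case: (@acyc [:: x, z & rcons p3 y]); first by rewrite /= size_rcons.
move: pxp2 up2 xp2; rewrite -cat_rcons cat_path cat_uniq mem_cat negb_or.
rewrite rcons_cons => /andP[pz _] /and3P[uz _ _] /andP[xz _].
apply/andP; split; last by rewrite /= -/(uniq (z :: rcons p3 y)) xz.
by rewrite /cycle rcons_path pz /= last_rcons esym.
Qed.

Lemma path_graph_of_degree_two : is_path_graph e.
Proof.
have [s [us ss sT]] := hamiltonian_path.
have fP x : index x s < size s by rewrite index_mem sT.
exists (size s), (fun x => Ordinal (fP x)).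
  apply: inj_card_bij.
    by move=> x y [] /index_inj; apply; rewrite ?sT.
  by rewrite card_ord -(card_uniqP us) (eq_card sT).
move=> x y /=; apply/idP/idP => [exy|].
  case: (ltngtP (index x s) (index y s)) => [lt|lt|/index_inj xy].
  - by rewrite (sorted_adjacent_index us ss _ exy lt) ?sT ?eqxx.
  - by rewrite orbC (@sorted_adjacent_index s y x) ?sT ?eqxx // esym.
  - by rewrite xy ?sT ?eirr // in exy.
have step u v : (index u s).+1 == index v s -> e u v.
  move/eqP=> uv; have := sortedP u ss (index u s).
  by rewrite uv index_mem sT !nth_index ?sT //; apply.
by case/orP=> /step //; rewrite esym.
Qed.

End TreesOfDegreeTwo.

(** * Linear orders as sets of pairs *)

Section CondorcetDomains.

Variable X : finType.
Implicit Types (R Q : {set X * X}) (D : {set {set X * X}}).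

Lemma linear_ordersP R :
  reflect [/\ forall x, (x, x) \notin R,
              forall x y z, (x, y) \in R -> (y, z) \in R -> (x, z) \in R
            & forall x y, x != y -> ((x, y) \in R) || ((y, x) \in R)]
          (R \in linear_orders X).
Proof.
rewrite inE; apply: (iffP and3P) => -[irr tr tot]; split.
- exact/forallP.
- move=> x y z xy yz.
  by have /forallP/(_ y)/forallP/(_ z) := forallP tr x; rewrite xy yz.
- by move=> x y xy; have /forallP/(_ y) := forallP tot x; rewrite xy.
- exact/forallP.
- apply/forallP=> x; apply/forallP=> y; apply/forallP=> z.
  by apply/implyP=> xy; apply/implyP=> yz; apply: tr xy yz.
- by apply/forallP=> x; apply/forallP=> y; apply/implyP; apply: tot.
Qed.

Lemma linear_order_neq R x y : R \in linear_orders X -> (x, y) \in R -> x != y.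
Proof.
by case/linear_ordersP=> irr _ _; apply: contraTneq => ->; apply: irr.
Qed.

Lemma linear_order_trans R y x z : R \in linear_orders X ->
  (x, y) \in R -> (y, z) \in R -> (x, z) \in R.
Proof. by case/linear_ordersP=> _ tr _; apply: tr. Qed.

Lemma linear_order_flip R x y : R \in linear_orders X -> x != y ->
  ((y, x) \in R) = ((x, y) \notin R).
Proof.
move=> RL xy; have [irr tr tot] := linear_ordersP _ RL.
have := tot _ _ xy; case: (boolP ((x, y) \in R)) => //= xyR _.
by apply/negP=> /(tr _ _ _ xyR); apply/negP/irr.
Qed.

Lemma linear_order_asym R x y : R \in linear_orders X ->
  (x, y) \in R -> (y, x) \notin R.
Proof.
by move=> RL xyR; rewrite (linear_order_flip RL (linear_order_neq RL xyR)) xyR.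
Qed.

Lemma linear_order_sub R Q : R \in linear_orders X -> Q \in linear_orders X ->
  R \subset Q -> R = Q.
Proof.
move=> RL QL /subsetP RQ; apply/eqP; rewrite eqEsubset; apply/andP; split.
  exact/subsetP.
apply/subsetP=> -[x y] xyQ; have xy := linear_order_neq QL xyQ.
apply/negPn/negP; rewrite -(linear_order_flip RL xy) => /RQ.
by apply/negP; apply: linear_order_asym xyQ.
Qed.

(** * Condorcet domains through their restrictions to three alternatives *)

Definition no_cyclic_triple D : Prop := forall A B C (a b c : X),
  A \in D -> B \in D -> C \in D ->
  (a, b) \in A -> (b, c) \in A -> (b, c) \in B -> (c, a) \in B ->
  (c, a) \in C -> (a, b) \in C -> False.

(** On the triple the orders read [abc], [bca], [cab]: this is the Condorcet paradox. In the profile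
    of these three voters each pair of the cycle has two supporters. *)
Lemma condorcet_no_cyclic_triple D :
  condorcet_domain D -> no_cyclic_triple D.
Proof.
move=> [_ Dac] A B C a b c AD BD CD abA bcA bcB caB caC abC.
pose P (i : 'I_3) := nth A [:: A; B; C] i.
have PD i : P i \in D by case: i => -[|[|[|]]].
suff /(Dac 3 P PD [:: a; b; c]) : cycle (majority P) [:: a; b; c] by [].
have cnt x y i j : i != j -> (x, y) \in P i -> (x, y) \in P j ->
    majority P x y.
  move=> ij xi xj; rewrite /majority.
  have : #|[set i; j]| <= #|[set k | (x, y) \in P k]|.
    by apply/subset_leq_card/subsetP=> k; rewrite !inE => /orP[]/eqP->.
  rewrite cards2 ij /= => le2; exact: (@leq_trans (2 * 2)) (leq_mul _ le2).
pose i0 : 'I_3 := @Ordinal 3 0 isT.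
pose i1 : 'I_3 := @Ordinal 3 1 isT.
pose i2 : 'I_3 := @Ordinal 3 2 isT.
by rewrite /= (cnt a b i0 i2) // (cnt b c i0 i1) // (cnt c a i1 i2).
Qed.

Section SubMajority.

Variables (D : {set {set X * X}}) (n : nat) (P : 'I_n -> {set X * X}).
Hypotheses (DL : D \subset linear_orders X) (Dtri : no_cyclic_triple D).
Hypothesis (PD : forall i, P i \in D).

Let voters (V : {set 'I_n}) x y := [set i in V | (x, y) \in P i].
Let submajority (V : {set 'I_n}) : rel X :=
  fun x y => #|V| < 2 * #|voters V x y|.

Let PL i : P i \in linear_orders X. Proof. exact: (subsetP DL). Qed.

Let voters_flip (V : {set 'I_n}) x y : x != y ->
  #|voters V x y| + #|voters V y x| = #|V|.
Proof.
move=> xy; rewrite -(cardsID [set i | (x, y) \in P i] V); congr (_ + _).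
  by apply: eq_card => i; rewrite !inE.
by apply: eq_card => i; rewrite !inE (linear_order_flip (PL i) xy) andbC.
Qed.

(** Two sets of voters that each exceed half of [V] must intersect, by inclusion-exclusion. *)
Let submajority_meet (V : {set 'I_n}) x y x' y' :
  submajority V x y -> submajority V x' y' ->
  exists i, (x, y) \in P i /\ (x', y') \in P i.
Proof.
rewrite /submajority => m m'.
have le : #|voters V x y :|: voters V x' y'| <= #|V|.
  by apply/subset_leq_card/subsetP=> i; rewrite !inE => /orP[]/andP[].
have : 0 < #|voters V x y :&: voters V x' y'|.
  by have := cardsUI (voters V x y) (voters V x' y'); lia.
case/card_gt0P=> i; rewrite !inE => /andP[/andP[_ i1] /andP[_ i2]].
by exists i.
Qed.

Let submajority_irr V : irreflexive (submajority V).
Proof.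
move=> x; apply/negP => m; have [i [xx _]] := submajority_meet m m.
by have /eqP := linear_order_neq (PL i) xx.
Qed.

(** An odd electorate has no ties, so a failure of transitivity gives a majority cycle on three
    alternatives. Any two of its majorities share a voter, and the three shared voters form a cyclic
    triple. *)
Let submajority_trans (V : {set 'I_n}) :
  odd #|V| -> transitive (submajority V).
Proof.
move=> oV y x z xy yz; apply/negPn/negP => xz.
have [i [i1 i2]] := submajority_meet xy yz.
have xz' := linear_order_neq (PL i) (linear_order_trans (PL i) i1 i2).
have zx : submajority V z x.
  by move: xz; rewrite /submajority; have := voters_flip V xz'; lia.
have [j [j1 j2]] := submajority_meet yz zx.
have [k [k1 k2]] := submajority_meet zx xy.
exact: (Dtri (PD i) (PD j) (PD k) i1 i2 j1 j2 k1 k2).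
Qed.

(* With an even number of voters, dropping one preserves strict majorities. *)
Let majority_sub : 0 < n ->
  exists2 V : {set 'I_n}, odd #|V| & subrel (majority P) (submajority V).
Proof.
move=> n0; case: (boolP (odd n)) => [on|en].
  exists setT; first by rewrite cardsT card_ord.
  move=> x y; rewrite /majority /submajority cardsT card_ord.
  by rewrite (eq_card (B := voters setT x y)) // => i; rewrite !inE.
pose i0 := Ordinal n0.
have cV : #|[set~ i0]| = n.-1 by rewrite cardsC1 card_ord.
exists [set~ i0]; first by rewrite cV; lia.
move=> x y; rewrite /majority /submajority cV => m.
have : #|[set i | (x, y) \in P i]| <= #|voters [set~ i0] x y|.+1.
  rewrite (cardsD1 i0 [set i | _]).
  rewrite (eq_card (A := _ :\ _) (B := voters [set~ i0] x y)).
    by case: (_ \in _); rewrite /= ?add0n ?add1n.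
  by move=> i; rewrite !inE.
by move: m en; move: #|_| #|_| => k l; lia.
Qed.

(** The majority relation lies inside the majority relation of an odd electorate, which is
    transitive and irreflexive. *)
Lemma no_cyclic_triple_acyclic : acyclic (majority P).
Proof.
case=> [//|x s] /= xs; exfalso.
(* Without voters the majority relation is empty and has no nonempty cycle. *)
have n0 : 0 < n.
  by move: xs; case: (n) P => [|//] P'; rewrite rcons_path; case: s => [|y s];
     rewrite /majority /= ?[#|_|]eq_card0 // => -[].
have [V oV sub] := majority_sub n0.
have := sub_path sub xs => /(order_path_min (submajority_trans oV)).
by rewrite all_rcons submajority_irr.
Qed.

End SubMajority.

(** The form in which maximality is used: membership in [D] becomes a condition on triples. *)
Lemma maximal_condorcet_mem D Q : maximal_condorcet_domain D ->
  Q \in linear_orders X -> no_cyclic_triple (Q |: D) -> Q \in D.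
Proof.
move=> [[DL _] Dmax] QL tri; apply/negPn/negP => QD.
have QDL : Q |: D \subset linear_orders X by rewrite subUset sub1set QL.
have /negP[] : ~~ (D \proper Q |: D).
  apply: Dmax; split=> // n P PD.
  exact: no_cyclic_triple_acyclic QDL tri PD.
by rewrite properE subsetUr subUset sub1set (negPf QD).
Qed.

(** * Swapping consecutive alternatives *)

Definition consecutive R (x y : X) : Prop :=
  (x, y) \in R /\ forall z, (x, z) \in R -> (z, y) \notin R.

Definition swap R (x y : X) : {set X * X} := (y, x) |: R :\ (x, y).

Lemma in_swap R x y p :
  (p \in swap R x y) = (p == (y, x)) || (p != (x, y)) && (p \in R).
Proof. by rewrite !inE. Qed.

Lemma swap_linear R x y : R \in linear_orders X -> consecutive R x y ->
  swap R x y \in linear_orders X.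
Proof.
move=> RL [xyR cons]; have [irr tr tot] := linear_ordersP _ RL.
have xy := linear_order_neq RL xyR.
apply/linear_ordersP; split.
- move=> z; rewrite in_swap (negPf (irr z)) andbF orbF.
  by apply: contra xy => /eqP[<- <-].
- move=> a b c; rewrite !in_swap.
  case/orP=> [/eqP[-> ->]|/andP[abxy ab]].
    case/orP=> [/eqP[yx _]|/andP[xcxy xc]]; first by rewrite yx eqxx in xy.
    rewrite [_ == (x, y)]xpair_eqE (eq_sym y) (negPf xy) /=; apply/orP; right.
    have cy : c != y by apply: contra xcxy => /eqP->.
    by rewrite (linear_order_flip RL cy) cons.
  case/orP=> [/eqP[by' ->]|/andP[bcxy bc]].
    subst b; have ax : a != x by apply: contra abxy => /eqP->.
    rewrite [_ == (x, y)]xpair_eqE (negPf xy) andbF /=; apply/orP; right.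
    rewrite eq_sym in ax; rewrite (linear_order_flip RL ax).
    by apply/negP=> /cons; rewrite ab.
  rewrite (tr _ _ _ ab bc) andbT; apply/orP; right.
  apply/negP=> /eqP[ax cy]; subst a c.
  by have := cons _ ab; rewrite bc.
- move=> a b ab; rewrite !in_swap.
  case: (eqVneq (a, b) (x, y)) => [[-> ->]|abxy]; first by rewrite eqxx orbT.
  case: (eqVneq (b, a) (x, y)) => [[-> ->]|baxy]; first by rewrite eqxx.
  by case/orP: (tot _ _ ab) => ->; rewrite !orbT.
Qed.

Lemma consecutive_injr R x y y' : R \in linear_orders X ->
  consecutive R x y -> consecutive R x y' -> y = y'.
Proof.
move=> RL [xy c] [xy' c']; apply/eqP/negPn/negP => yy'.
by have := c' _ xy; rewrite -(linear_order_flip RL yy') (negPf (c _ xy')).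
Qed.

Lemma consecutive_injl R x x' y : R \in linear_orders X ->
  consecutive R x y -> consecutive R x' y -> x = x'.
Proof.
move=> RL [xy c] [xy' c']; apply/eqP/negPn/negP => xx'.
case: (boolP ((x, x') \in R)) => [/c|]; first by rewrite xy'.
by rewrite -(linear_order_flip RL xx') => /c'; rewrite xy.
Qed.

(** Among the pairs of [R] that [R'] reverses, take one with the fewest alternatives between its
    members in [R]. *)
Lemma consecutive_disagreement R R' :
  R \in linear_orders X -> R' \in linear_orders X -> R != R' ->
  exists x y, consecutive R x y /\ (y, x) \in R'.
Proof.
move=> RL RL' RR'.
have [[x0 y0] d0] : exists p, p \in R :\: R'.
  apply/set0Pn; apply: contra RR'; rewrite setD_eq0.
  by move=> /(linear_order_sub RL RL')->.
pose m (p : X * X) := #|[set z | ((p.1, z) \in R) && ((z, p.2) \in R)]|.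
case: (arg_minnP m d0) => -[x y] /setDP[xyR xyR'] mmin.
exists x, y; split; last first.
  by rewrite (linear_order_flip RL' (linear_order_neq RL xyR)).
split=> // z xz; apply/negP => zy.
(* By minimality, no other disagreement has its intermediate alternatives among those of [(x, y)]
   while omitting [z]. *)
have lt p : p \in R :\: R' ->
    (forall w, (p.1, w) \in R -> (w, p.2) \in R ->
       [/\ (x, w) \in R, (w, y) \in R & w != z]) -> False.
  move=> pd sub; have := mmin _ pd; rewrite leqNgt => /negP[].
  apply/proper_card/properP; split.
    by apply/subsetP=> w; rewrite !inE => /andP[/sub H /H[-> ->]].
  exists z; rewrite !inE ?xz ?zy //.
  by apply/negP=> /andP[/sub H /H[_ _]]; rewrite eqxx.
(* Since [R'] does not rank [x] above [y], transitivity forces it to reverse [(x, z)] or [(z, y)],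
   both closer pairs. *)
case: (boolP ((x, z) \in R')) => xz'; last first.
  apply: (lt (x, z)) => /=; first by rewrite inE xz' xz.
  move=> w xw wz; split=> //; first exact: linear_order_trans wz zy.
  exact: linear_order_neq wz.
apply: (lt (z, y)) => /=.
  rewrite inE zy andbT; apply: contra xyR'; exact: linear_order_trans xz'.
move=> w zw wy; split=> //; first exact: linear_order_trans xz zw.
by rewrite eq_sym; apply: linear_order_neq zw.
Qed.

(** * Adjacency and walks in the associated graph *)

Section Graph.

Variable D : {set {set X * X}}.
Hypothesis DL : D \subset linear_orders X.

Local Notation e := (@associated_graph X D).
Local Notation vertex := {R : {set X * X} | R \in D}.

Let vL (S : vertex) : val S \in linear_orders X.
Proof. exact: (subsetP DL) (valP S). Qed.

Lemma order_interval_ends (U V : vertex) :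
  [set val U; val V] \subset order_interval (val U) (val V) :&: D.
Proof.
apply/subsetP=> W; rewrite /order_interval => /set2P[]->;
  (apply/setIP; split; last exact: valP); rewrite in_set vL /=.
  exact: subsetIl.
exact: subsetIr.
Qed.

(** The intersection of [U] and [V] is [U] without [(x, y)], so an order in the interval is
    determined by how it ranks [x] and [y]. *)
Lemma swap_adjacent (U V : vertex) x y :
  (x, y) \in val U -> val V = swap (val U) x y -> e U V.
Proof.
move=> xyU VE.
have xy := linear_order_neq (vL U) xyU.
have yxV : (y, x) \in val V by rewrite VE in_swap eqxx.
rewrite /associated_graph; apply/andP; split.
  by apply: contraL yxV => /eqP <-; apply: linear_order_asym xyU.
rewrite eqEsubset order_interval_ends andbT.
apply/subsetP=> W /setIP[]; rewrite inE => /andP[WL /subsetP UVW] WD.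
have UW p : p \in val U -> p != (x, y) -> p \in W.
  by move=> pU pxy; apply: UVW; rewrite inE pU VE in_swap pxy pU orbT.
rewrite !inE; case: (boolP ((x, y) \in W)) => xyW.
  apply/orP; left; rewrite eq_sym; apply/eqP/linear_order_sub => //.
  by apply/subsetP=> p pU; case: (eqVneq p (x, y)) => [->//|]; apply: UW.
apply/orP; right; rewrite eq_sym; apply/eqP/linear_order_sub => //.
apply/subsetP=> p; rewrite VE in_swap => /orP[/eqP->|/andP[pxy pU]].
  by rewrite (linear_order_flip WL xy).
exact: UW.
Qed.

(** Induction on the number of disagreements: if [S] and [T] are not adjacent, a third member [Q] of
    [D] lies between them, and it contains [p] because it contains their intersection. Leaving [f]
    arbitrary allows walks in the graph with an edge deleted. *)
Lemma connect_sharing_pair (f : rel vertex) (p : X * X) :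
  (forall S T : vertex, p \in val S -> p \in val T -> e S T -> connect f S T) ->
  forall S T : vertex, p \in val S -> p \in val T -> connect f S T.
Proof.
move=> ef S T; move: {2}_.+1 (ltnSn (#|val S :\: val T|)) => m.
elim: m S T => // m IH S T; rewrite ltnS => Sm pS pT.
case: (eqVneq S T) => [->//|ST].
case: (boolP (e S T)) => [|]; first exact: ef.
rewrite /associated_graph ST /= eqEsubset order_interval_ends andbT.
case/subsetPn=> Q /setIP[]; rewrite inE => /andP[QL /subsetP STQ] QD.
rewrite !inE negb_or => /andP[QS QT].
pose q : vertex := Sub Q QD.
have pq : p \in val q by apply: STQ; rewrite inE pS.
(* Reversing pairs turns the inclusion of the intersection of [S] and [T] in [Q] into the inclusion
   of [Q] in their union. *)
have QsubST p' : p' \in Q -> p' \notin val T -> p' \in val S.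
  case: p' => a b abQ abT; have ab := linear_order_neq QL abQ.
  apply/negPn; rewrite -(linear_order_flip (vL S) ab).
  apply/negP=> baS; have /negP[] := linear_order_asym QL abQ.
  by apply: STQ; rewrite inE baS (linear_order_flip (vL T) ab).
(* Both [S :\: Q] and [Q :\: T] are proper subsets of [S :\: T], because [Q] is neither [T] nor
   [S]. *)
apply: (@connect_trans _ _ q); apply: IH => //; apply: leq_trans Sm;
  apply/proper_card; rewrite properE; apply/andP; split.
- apply/subsetP=> p'; rewrite !inE => /andP[p'Q p'S]; rewrite p'S andbT.
  by apply: contra p'Q => p'T; apply: STQ; rewrite inE p'S.
- apply: contra QT => /subsetP sub.
  apply/eqP/(linear_order_sub QL (vL T))/subsetP=> p' p'Q.
  apply/negPn/negP => p'T; have := sub p'; rewrite !inE p'T /= p'Q.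
  by rewrite (QsubST _ p'Q p'T) => /(_ isT).
- apply/subsetP=> p'; rewrite !inE => /andP[p'T p'Q].
  by rewrite p'T QsubST.
- apply: contra QS => /subsetP sub; rewrite eq_sym.
  apply/eqP/(linear_order_sub (vL S) QL)/subsetP=> p' p'S.
  case: (boolP (p' \in val T)) => p'T; first by apply: STQ; rewrite inE p'S.
  by have := sub p'; rewrite !inE p'T p'S => /(_ isT).
Qed.

End Graph.

(** * Edges are swaps, and vertices have degree at most two *)

Section Main.

Variable D : {set {set X * X}}.
Hypothesis Dmax : maximal_condorcet_domain D.
Hypothesis Dtree : is_tree (@associated_graph X D).

Local Notation e := (@associated_graph X D).
Local Notation vertex := {R : {set X * X} | R \in D}.

Let DL : D \subset linear_orders X. Proof. by case: Dmax => -[]. Qed.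
Let Dtri : no_cyclic_triple D.
Proof. by apply: condorcet_no_cyclic_triple; case: Dmax. Qed.
Let vL (S : vertex) : val S \in linear_orders X.
Proof. exact: (subsetP DL) (valP S). Qed.
Let Dacyc : forall s : seq vertex, 2 < size s -> ~ ucycle e s.
Proof. by case: Dtree. Qed.

(** A walk through orders containing [p] cannot use the edge, since one of its ends lacks [p]. *)
Let connect_bypass (R R' S T : vertex) p : p \in val S -> p \in val T ->
  ~~ ((p \in val R) && (p \in val R')) -> connect (delete_edge e R R') S T.
Proof.
move=> pS pT pRR'; apply: connect_sharing_pair pS pT => // U V pU pV eUV.
apply: connect1; rewrite /delete_edge eUV; apply: contra pRR' => /eqP/setP UV.
have mem W : W \in [set R; R'] -> p \in val W.
  by rewrite -UV !inE => /orP[]/eqP->.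
by rewrite !mem ?set21 ?set22.
Qed.

(** The walk goes from [R] to [B] along [(x, y)], from [B] to [C] along [q], and from [C] to [R']
    along [(y, x)]. Each of these pairs is missing from an end of the edge, so the edge would not be
    a bridge. *)
Let no_bypass (R R' B C : vertex) x y q : e R R' ->
  (x, y) \in val R -> (y, x) \in val R' ->
  (x, y) \in val B -> (y, x) \in val C ->
  q \in val B -> q \in val C -> q \notin val R -> False.
Proof.
move=> eRR' xyR yxR' xyB yxC qB qC qR.
have /negP[] := tree_edge_is_bridge (@associated_graph_sym X D)
  (@associated_graph_irr X D) Dacyc eRR'.
have xyR' := linear_order_asym (vL R') yxR'.
have yxR := linear_order_asym (vL R) xyR.
apply: (@connect_trans _ _ B).
  by apply: (connect_bypass xyR xyB); rewrite (negPf xyR') andbF.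
apply: (@connect_trans _ _ C).
  by apply: (connect_bypass qB qC); rewrite (negPf qR).
by apply: (connect_bypass yxC yxR'); rewrite (negPf yxR).
Qed.

Lemma adjacent_swap_mem (R R' : vertex) x y : e R R' ->
  consecutive (val R) x y -> (y, x) \in val R' -> swap (val R) x y \in D.
Proof.
move=> eRR' xyR yxR'; set Q := swap _ _ _.
have QL : Q \in linear_orders X by apply: swap_linear.
have xyR1 : (x, y) \in val R by case: xyR.
(* The new order [Q] cannot be the first member of a cyclic triple. The other two contain [(c, a)]
   while [Q] contains [(a, c)], so they are old members of [D]. *)
have no_Q B C a b c : B \in Q |: D -> C \in Q |: D ->
    (a, b) \in Q -> (b, c) \in Q -> (b, c) \in B -> (c, a) \in B ->
    (c, a) \in C -> (a, b) \in C -> False.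
  move=> BQD CQD abQ bcQ bcB caB caC abC.
  have acQ := linear_order_trans QL abQ bcQ.
  have caQ := linear_order_asym QL acQ.
  have BD : B \in D by case/setU1P: BQD => // BQ; rewrite -BQ caB in caQ.
  have CD : C \in D by case/setU1P: CQD => // CQ; rewrite -CQ caC in caQ.
  pose vB : vertex := Sub B BD; pose vC : vertex := Sub C CD.
  have QR p : p \in Q -> p != (y, x) -> p \in val R.
    by rewrite in_swap => /orP[->//|/andP[]].
  have baB : (b, a) \in B := linear_order_trans (vL vB) bcB caB.
  have cbC : (c, b) \in C := linear_order_trans (vL vC) caC abC.
  have ab := linear_order_neq QL abQ.
  have bc := linear_order_neq QL bcQ.
  (* If the triple takes the reversed pair [(y, x)] from [Q], then [B] and [C] disagree on [x] and
     [y] but share [(c, a)], which [R] lacks. Otherwise [R] can replace [Q], giving a cyclic triple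
     in [D]. *)
  case: (eqVneq (a, b) (y, x)) => [[ay bx]|abyx].
    subst a b.
    apply: (@no_bypass R R' vB vC x y (c, y)) => //.
    apply: linear_order_asym => //; apply: QR => //.
    by rewrite xpair_eqE eqxx /= eq_sym.
  case: (eqVneq (b, c) (y, x)) => [[by' cx]|bcyx].
    subst b c.
    apply: (@no_bypass R R' vC vB x y (x, a)) => //.
    apply: linear_order_asym => //; apply: QR => //.
    by rewrite xpair_eqE eqxx andbT.
  by apply: (@Dtri (val R) B C a b c) => //; [exact: valP|apply: QR|apply: QR].
apply: maximal_condorcet_mem Dmax QL _ => A B C a b c.
move=> AQ BQ CQ abA bcA bcB caB caC abC.
(* A cyclic rotation of the triple brings [Q] to the front. *)
case/setU1P: (AQ) => [AE|AD]; first by subst A; apply: (@no_Q B C a b c).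
case/setU1P: (BQ) => [BE|BD]; first by subst B; apply: (@no_Q C A b c a).
case/setU1P: (CQ) => [CE|CD]; first by subst C; apply: (@no_Q A B c a b).
exact: (@Dtri A B C a b c).
Qed.

(** The swapped order lies in [D] and between [R] and [R'], so adjacency makes it one of the two,
    and it is not [R]. *)
Lemma adjacent_is_swap (R R' : vertex) : e R R' ->
  exists x y, consecutive (val R) x y /\ val R' = swap (val R) x y.
Proof.
move=> eRR'; have /andP[RR' /eqP int] := eRR'.
have [x [y [xyR yxR']]] := consecutive_disagreement (vL R) (vL R') RR'.
exists x, y; split=> //.
have QD := adjacent_swap_mem eRR' xyR yxR'.
have : swap (val R) x y \in order_interval (val R) (val R') :&: D.
  rewrite inE QD andbT inE (subsetP DL) //=; apply/subsetP=> p /setIP[pR pR'].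
  rewrite in_swap pR andbT; apply/orP; right.
  by apply: contraTneq pR' => ->; apply: linear_order_asym yxR'.
rewrite int !inE => /orP[]/eqP QE //.
have : (y, x) \in val R by rewrite -QE in_swap eqxx.
by have := linear_order_asym (vL R) xyR.1 => /negPf->.
Qed.

(** Once the doubly swapped order [Q] is known to be in [D], the vertices [R], [R1], [Q], [R2] form
    a 4-cycle. *)
Lemma disjoint_swaps (R R1 R2 : vertex) x1 y1 x2 y2 :
  consecutive (val R) x1 y1 -> consecutive (val R) x2 y2 ->
  val R1 = swap (val R) x1 y1 -> val R2 = swap (val R) x2 y2 ->
  x1 != x2 -> y1 != y2 -> x1 != y2 -> y1 != x2 -> False.
Proof.
move=> c1 c2 R1E R2E xx yy xy yx.
have [xy1 _] := c1; have [xy2 _] := c2.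
pose Q := swap (val R1) x2 y2.
have QE : Q = swap (val R2) x1 y1.
  apply/setP=> p; rewrite /Q R1E R2E !in_swap.
  case: (eqVneq p (y2, x2)) => [->|_].
    by rewrite !xpair_eqE (eq_sym y2 x1) (negPf xy) orbT.
  case: (eqVneq p (x2, y2)) => [->|_] //=.
  by rewrite !xpair_eqE (eq_sym x2 y1) (negPf yx) !andbF.
have R1R p : p != (y1, x1) -> p \in val R1 -> p \in val R.
  by rewrite R1E in_swap => /negPf-> /andP[].
have c2' : consecutive (val R1) x2 y2.
  split; first by rewrite R1E in_swap xy2 [_ == (x1, y1)]xpair_eqE (eq_sym x2) (negPf xx) orbT.
  move=> z x2z; apply/negP=> zy2.
  have /c2.2/negP[] : (x2, z) \in val R.
    by apply: R1R x2z; rewrite xpair_eqE eq_sym (negPf yx).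
  by apply: R1R zy2; rewrite xpair_eqE (eq_sym y2) (negPf xy) andbF.
have QL : Q \in linear_orders X by apply: swap_linear.
have QD : Q \in D.
  apply: maximal_condorcet_mem Dmax QL _.
  (* Two disjoint pairs do not fit into three alternatives, so the triple misses one of the reversed
     pairs. On the listed pairs [Q] can then be replaced by [R2] or [R1], the order without that
     reversal. *)
  have agree A a b c : A \in Q |: D -> exists2 U, U \in D &
      forall p, p \in [:: (a, b); (b, c); (c, a)] -> p \in A -> p \in U.
    case/setU1P=> [->|AD]; last by exists A.
    case: (boolP ((y1, x1) \in [:: (a, b); (b, c); (c, a)])) => l1; last first.
      exists (val R2) => [|p pl]; first exact: valP.
      by rewrite QE in_swap (negPf (memPn l1 _ pl)) => /andP[].
    case: (boolP ((y2, x2) \in [:: (a, b); (b, c); (c, a)])) => l2; last first.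
      exists (val R1) => [|p pl]; first exact: valP.
      by rewrite in_swap (negPf (memPn l2 _ pl)) => /andP[].
    exfalso; move: l1 l2 xx yy xy yx; rewrite !inE.
    by case/or3P=> /eqP[-> ->] /or3P[] /eqP[-> ->]; rewrite ?eqxx.
  move=> A B C a b c /(agree _ a b c)[A' AD' AA'] /(agree _ a b c)[B' BD' BB'].
  move=> /(agree _ a b c)[C' CD' CC'] abA bcA bcB caB caC abC.
  by apply: (@Dtri A' B' C' a b c);
    rewrite ?(AA', BB', CC') // !inE eqxx ?orbT.
pose vQ : vertex := Sub Q QD.
have y1x1R := linear_order_asym (vL R) xy1.
have y1x1R1 : (y1, x1) \in val R1 by rewrite R1E in_swap eqxx.
have y1x1R2 : (y1, x1) \notin val R2.
  by rewrite R2E in_swap xpair_eqE (negPf yy) (negPf y1x1R) andbF.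
have y1x1Q : (y1, x1) \in val vQ by rewrite /= QE in_swap eqxx.
have eR1 : e R R1 by apply: swap_adjacent xy1 R1E.
have eR2 : e R R2 by apply: swap_adjacent xy2 R2E.
have eR1Q : e R1 vQ by apply: swap_adjacent c2'.1 _.
have eR2Q : e R2 vQ.
  apply: (swap_adjacent DL (V := vQ) _ QE).
  by rewrite R2E in_swap xy1 [_ == (x2, y2)]xpair_eqE (negPf xx) orbT.
have neq U V : e U V -> U != V by case/andP.
apply: (Dacyc (s := [:: R; R1; vQ; R2])) => //; apply/andP; split.
  by rewrite /= eR1 eR1Q associated_graph_sym eR2Q associated_graph_sym eR2.
have RQ : R != vQ by apply: contra y1x1R => /eqP->.
have R12 : R1 != R2 by apply: contra y1x1R2 => /eqP<-.
have QR2 : vQ != R2 by rewrite eq_sym neq.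
by rewrite /= !inE !negb_or RQ R12 QR2 !neq.
Qed.

(** Any two of the three swapped pairs overlap, and consecutive pairs overlap only by one starting
    where the other ends. Three pairs cannot all do so along a linear order. *)
Lemma degree_at_most_two (R R1 R2 R3 : vertex) :
  uniq [:: R1; R2; R3] -> e R R1 -> e R R2 -> e R R3 -> False.
Proof.
move=> u e1 e2 e3.
have [x1 [y1 [c1 E1]]] := adjacent_is_swap e1.
have [x2 [y2 [c2 E2]]] := adjacent_is_swap e2.
have [x3 [y3 [c3 E3]]] := adjacent_is_swap e3.
have overlap (R' R'' : vertex) x y x' y' : R' != R'' ->
    consecutive (val R) x y -> consecutive (val R) x' y' ->
    val R' = swap (val R) x y -> val R'' = swap (val R) x' y' ->
    [/\ x <> x', y <> y' & x = y' \/ y = x'].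
  move=> R'R'' c c' E E'.
  have xx' : x != x'.
    apply: contra R'R'' => /eqP xx'; subst x'.
    by rewrite -val_eqE E E' (consecutive_injr (vL R) c c').
  have yy' : y != y'.
    apply: contra R'R'' => /eqP yy'; subst y'.
    by rewrite -val_eqE E E' (consecutive_injl (vL R) c c').
  split; [exact/eqP | exact/eqP |].
  case: (eqVneq x y') => [|xy']; first by left.
  case: (eqVneq y x') => [|yx']; first by right.
  by case: (disjoint_swaps c c' E E').
have [n12 n13 n23] : [/\ R1 != R2, R1 != R3 & R2 != R3].
  by move: u; rewrite /= !inE negb_or => /andP[/andP[-> ->] /andP[-> _]].
have [xx12 yy12 o12] := overlap _ _ _ _ _ _ n12 c1 c2 E1 E2.
have [xx13 yy13 o13] := overlap _ _ _ _ _ _ n13 c1 c3 E1 E3.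
have [xx23 yy23 o23] := overlap _ _ _ _ _ _ n23 c2 c3 E2 E3.
have no_cycle a b c : (a, b) \in val R -> (b, c) \in val R ->
    (c, a) \in val R -> False.
  move=> ab bc; apply/negP/(linear_order_asym (vL R)).
  exact: linear_order_trans (vL R) ab bc.
move: c1.1 c2.1 c3.1 => p1 p2 p3.
(* In six of the eight cases two upper or two lower alternatives coincide; the two cyclic cases
   close a 3-cycle in [R]. *)
case: o12 o13 o23 => o12 [o13|o13] [o23|o23]; try congruence.
  rewrite o13 in p1; rewrite -o12 in p2; rewrite -o23 in p3.
  exact: no_cycle p1 p3 p2.
rewrite o12 in p1; rewrite o23 in p2; rewrite -o13 in p3.
exact: no_cycle p1 p2 p3.
Qed.

End Main.
End CondorcetDomains.

Theorem theorem7 (X : finType) (D : {set {set X * X}})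
    (Dmax : maximal_condorcet_domain D)
    (Dtree : is_tree (@associated_graph X D)) :
  is_path_graph (@associated_graph X D).
Proof.
have [_ conn acyc] := Dtree.
apply: path_graph_of_degree_two => //.
- exact: associated_graph_sym.
- exact: associated_graph_irr.
- move=> R R1 R2 R3; exact: degree_at_most_two.
Qed.
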